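(* Let $M$ be a set of $n$ men and $W$ a set of $n$ women, $n \ge 2$. Let $f$ be the allocation rule that maps each profile of reported preferences $P = (\{\succ_m\}_{m \in M}, \{\succ_w\}_{w \in W})$ to the matching returned by the man-proposing accelerated deferred acceptance (ADA) algorithm run on $P$. Then $f$ is strategy proof for the men: for every man $m \in M$, reporting his true preference relation is a weakly dominant strategy. That is, for every man $m$, every true preference relation $\succ_m$ of $m$, every alternative report $\succ'_m$ of $m$, and every profile $P_{-m}$ of reported preferences of the other $2n-1$ participants, if $\mu = f(\succ_m, P_{-m})$ and $\mu' = f(\succ'_m, P_{-m})$, then either $\mu(m) = \mu'(m)$ or $\mu(m) \succ_m \mu'(m)$.
   Context: Instance. $M$ is a set of $n$ men and $W$ is a set of $n$ women, $n \ge 2$. A preference profile (instance of the stable matching problem) $P$ consists of, for each man $m \in M$, a strict preference relation (strict linear order) $\succ_m$ on all of $W$, and, for each woman $w \in W$, a strict preference relation (strict linear order) $\succ_w$ on all of $M$. A matching is a bijective pairing of $M$ with $W$, i.e. a map $\mu : M \cup W \to M \cup W$ with $\mu(m) \in W$ for $m \in M$, $\mu(w) \in M$ for $w \in W$, and $\mu(m) = w$ if and only if $\mu(w) = m$. An allocation rule is a mapping from the reported preferences of all $2n$ participants to the set of matchings. The man-proposing ADA algorithm. It proceeds in rounds $1, 2, 3, \dots$. Initially all men are single, no woman has rejected any man, and no one is matched. Each round has three steps: 1. Each man who is single at the start of the round proposes to his most preferred woman among those who have not yet rejected him. 2. Each woman $w$ who holds at least one proposal tentatively accepts her most preferred proposer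 $m^*$ (with respect to $\succ_w$), where the proposers of $w$ in a round are the men who propose to her in that round together with the man, if any, with whom she was tentatively matched at the end of the previous round. She then rejects all men in $M$ that she ranks below $m^*$, whether or not they have proposed to her. Rejections are permanent. 3. The man accepted by $w$ is tentatively matched with $w$; every man who is not tentatively matched at the end of the round is single for the next round. The algorithm terminates at the end of the first round after which no man is single, and it returns the current set of tentatively matched pairs (it always terminates, and its output is a matching). *)

(* Defs.v *)
(* MathComp world. *)
From HB Require Import structures.
From mathcomp Require Import all_boot.

Set Implicit Arguments.
Unset Strict Implicit.
Unset Printing Implicit Defensive.

Definition strict_linear_order (T : Type) (r : rel T) : Prop :=
  [/\ irreflexive r, transitive r & forall x y, x <> y -> r x y || r y x].

(* [r x y] reads "x is strictly preferred to y". *)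
Record pref (T : Type) := Pref {
  pref_rel :> rel T;
  pref_slo : strict_linear_order pref_rel
}.

Record profile (M W : Type) := Profile {
  mpref : M -> pref W;
  wpref : W -> pref M
}.

(* The map mu on the disjoint union of M and W that exchanges the two sides,
   given by its restrictions to M and to W. *)
Record matching (M W : Type) := Matching {
  wife : M -> W;
  husband : W -> M;
  matchingP : forall m w, wife m = w <-> husband w = m
}.

Definition allocation_rule (M W : Type) := profile M W -> matching M W.

(* The profile (r, P_{-m}): the report of m in P is replaced by r. *)
Definition report (M : eqType) (W : Type) (P : profile M W) (m : M)
    (r : pref W) : profile M W :=
  Profile (fun m' => if m' == m then r else mpref P m') (wpref P).

(* [r] is the true preference of m, [r'] an alternative report; the component
   of P at m is overwritten on both sides, so P only contributes P_{-m}. *)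
Definition strategy_proof_for_men (M : eqType) (W : Type)
    (f : allocation_rule M W) : Prop :=
  forall (m : M) (r r' : pref W) (P : profile M W),
    let mu := f (report P m r) in
    let mu' := f (report P m r') in
    wife mu m = wife mu' m \/ r (wife mu m) (wife mu' m).

Definition is_best (T : finType) (r : rel T) (A : {set T}) (x : T) : bool :=
  (x \in A) && [forall y in A, (y != x) ==> r x y].

Section Algorithm.
Variables M W : finType.
Implicit Types (P : profile M W) (m : M) (w : W).

(* (m, w) \in rejected s means that w has rejected m. *)
Record ada_state := AdaState {
  matched : {set M * W};
  rejected : {set M * W}
}.
Implicit Type s : ada_state.

Definition ada_init : ada_state := AdaState set0 set0.

Definition single s m : bool := [forall w, (m, w) \notin matched s].

Definition proposes P s m w : bool :=
  single s m && is_best (mpref P m) [set w' | (m, w') \notin rejected s] w.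

Definition proposers P s w : {set M} :=
  [set m | ((m, w) \in matched s) || proposes P s m w].

Definition accepts P s w m : bool := is_best (wpref P w) (proposers P s w) m.

(* A woman rejects every man below the accepted one, proposer or not. *)
Definition ada_round P s : ada_state :=
  AdaState [set p | accepts P s p.2 p.1]
           (rejected s :|:
            [set p | [exists m, accepts P s p.2 m && wpref P p.2 m p.1]]).

Definition ada_after P (k : nat) : ada_state := iter k (ada_round P) ada_init.

Definition no_single s : bool := [forall m, ~~ single s m].

Lemma is_best_in (T : finType) (r : rel T) (A : {set T}) x :
  is_best r A x -> x \in A.
Proof. by case/andP. Qed.

Lemma is_best_rel (T : finType) (r : rel T) (A : {set T}) x y :
  is_best r A x -> y \in A -> y != x -> r x y.
Proof. by case/andP=> _ /forall_inP h yA; move/implyP: (h y yA); apply. Qed.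

Lemma is_best_uniq (T : finType) (r : pref T) (A : {set T}) x y :
  is_best r A x -> is_best r A y -> x = y.
Proof.
move=> bx by_; apply/eqP/negPn/negP => nxy.
have rxy := is_best_rel bx (is_best_in by_).
have ryx := is_best_rel by_ (is_best_in bx) nxy.
case: (pref_slo r) => irr tr _.
by move: (irr x); rewrite (tr _ _ _ (rxy _) ryx) // eq_sym.
Qed.

Lemma is_best_ex (T : finType) (r : pref T) (A : {set T}) x :
  x \in A -> exists y, is_best r A y.
Proof.
move=> xA; case: (pref_slo r) => irr tr tot.
case: (@arg_maxnP _ x (mem A) (fun y => #|[set z in A | r y z]|) xA) => y yA ymax.
exists y; apply/andP; split=> //; apply/forall_inP => z zA.
apply/implyP => nzy; have /orP[rzy|//] := tot z y (elimN eqP nzy).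
suff : #|[set u in A | r y u]| < #|[set u in A | r z u]|.
  by rewrite ltnNge; move/negP; case; apply: ymax.
apply: proper_card; apply/properP; split.
  apply/subsetP => u; rewrite !inE => /andP[-> ryu] /=.
  exact: tr rzy ryu.
have yA' : y \in A by [].
by exists y; rewrite !inE yA' ?rzy ?irr.
Qed.

Definition ada_inv s : Prop :=
  [/\ forall m w, (m, w) \in matched s -> (m, w) \notin rejected s,
      forall m w w', (m, w) \in matched s -> (m, w') \in matched s -> w = w',
      forall m m' w, (m, w) \in matched s -> (m', w) \in matched s -> m = m'
    & forall m w, (m, w) \in rejected s -> exists m', (m', w) \in matched s].

Lemma not_single s m w : (m, w) \in matched s -> single s m = false.
Proof. by move=> mw; apply/negP => /forallP /(_ w); rewrite mw. Qed.

Lemma ada_inv_round P s : ada_inv s -> ada_inv (ada_round P s).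
Proof.
case=> I1 I2 I3 I4; split.
- move=> m w; rewrite !inE /= => acc; apply/negP => /orP[rej|].
    move: (is_best_in acc); rewrite inE => /orP[/I1|]; first by rewrite rej.
    by case/andP=> _ /is_best_in; rewrite inE rej.
  case/existsP=> m' /andP[acc' rm].
  rewrite (is_best_uniq acc' acc) in rm.
  by case: (pref_slo (wpref P w)) => irr _ _; rewrite irr in rm.
- move=> m w w'; rewrite !inE /= => /is_best_in + /is_best_in.
  rewrite !inE => /orP[mw|/andP[sm b]] /orP[mw'|/andP[sm' b']].
  + exact: I2 mw mw'.
  + by rewrite (not_single mw) in sm'.
  + by rewrite (not_single mw') in sm.
  + exact: is_best_uniq b b'.
- by move=> m m' w; rewrite !inE /=; apply: is_best_uniq.
- move=> m w; rewrite !inE /= => /orP[/I4[m' mw]|/existsP[m' /andP[acc _]]].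
    have mp : m' \in proposers P s w by rewrite inE mw.
    by have [m2 b] := is_best_ex (wpref P w) mp; exists m2; rewrite inE.
  by exists m'; rewrite inE.
Qed.

Lemma ada_inv_after P k : ada_inv (ada_after P k).
Proof.
elim: k => [|k IH]; last exact: ada_inv_round.
by split=> [m w|m w w'|m m' w|m w]; rewrite inE.
Qed.

Lemma single_has_candidate s m : ada_inv s -> #|M| = #|W| -> single s m ->
  exists w, (m, w) \notin rejected s.
Proof.
case=> I1 I2 I3 I4 cMW sm.
have [/existsP //|] := boolP [exists w, (m, w) \notin rejected s].
rewrite negb_exists => /forallP rej.
have h w : exists m', (m', w) \in matched s.
  by apply: (I4 m); move: (rej w); rewrite negbK.
pose g w := xchoose (h w); have gP w : (g w, w) \in matched s := xchooseP (h w).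
have ginj : injective g.
  by move=> w w' e; apply: (I2 (g w)) => //; rewrite e.
have := subset_leq_card (_ : g @: W \subset [set~ m]).
rewrite card_imset // cardsC1 -cMW => H.
have : 0 < #|M| by apply/card_gt0P; exists m.
case: #|M| H => // c /= H _; suff: c < c by rewrite ltnn.
apply: H; apply/subsetP => _ /imsetP[w _ ->]; rewrite !inE.
by apply/negP => /eqP e; move: (gP w); rewrite e => /not_single; rewrite sm.
Qed.

Lemma single_new_rejection P s m : ada_inv s -> #|M| = #|W| ->
  single (ada_round P s) m -> #|rejected s| < #|rejected (ada_round P s)|.
Proof.
move=> inv cMW sm.
have [w [mw nrej]] : exists w, m \in proposers P s w /\ (m, w) \notin rejected s.
  case sms: (single s m).
    have [w0 w0P] := single_has_candidate inv cMW sms.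
    have w0A : w0 \in [set w' | (m, w') \notin rejected s] by rewrite inE.
    have [w b] := is_best_ex (mpref P m) w0A.
    exists w; move: (is_best_in b); rewrite !inE => nrej; split=> //.
    by rewrite /proposes sms b orbT.
  move/negbT: sms; rewrite negb_forall => /existsP[w]; rewrite negbK => mw.
  by exists w; rewrite inE mw; case: inv => I1 _ _ _; split=> //; apply: I1.
have [m' acc] := is_best_ex (wpref P w) mw.
have nmm : m != m'.
  apply/eqP => e; move/forallP/(_ w): sm; rewrite inE /= e.
  by rewrite /accepts acc.
apply: proper_card; apply/properP; split; first exact: subsetUl.
exists (m, w) => //; rewrite !inE /=; apply/orP; right.
apply/existsP; exists m'; rewrite /accepts acc /=.
exact: is_best_rel acc mw nmm.
Qed.

Lemma ada_terminates P : #|M| = #|W| ->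
  exists k, no_single (ada_after P k.+1).
Proof.
move=> cMW; pose N := #|{: M * W}|.
have [/existsP[k hk]|] :=
  boolP [exists k : 'I_N.+1, no_single (ada_after P k.+1)].
  by exists k.
rewrite negb_exists => /forallP H.
have grow k : k <= N.+1 -> k <= #|rejected (ada_after P k)|.
  elim: k => // k IH kN; apply: leq_ltn_trans (IH (ltnW kN)) _.
  move: (H (Ordinal kN)); rewrite negb_forall => /existsP[m].
  by rewrite negbK; apply: single_new_rejection => //; apply: ada_inv_after.
by have := leq_trans (grow _ (leqnn _)) (max_card _); rewrite ltnn.
Qed.

Section Output.
Variables (n : nat) (cardM : #|M| = n) (cardW : #|W| = n).

Let cardMW : #|M| = #|W| := etrans cardM (esym cardW).

(* Round [ada_last_round P] (rounds are numbered from 1) is the first round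
   after which no man is single. *)
Definition ada_last_round P : nat := (ex_minn (ada_terminates P cardMW)).+1.

Definition ada_pairs P : {set M * W} := matched (ada_after P (ada_last_round P)).

Lemma ada_pairs_inj P m w w' :
  (m, w) \in ada_pairs P -> (m, w') \in ada_pairs P -> w = w'.
Proof. by case: (ada_inv_after P (ada_last_round P)) => _ I2 _ _; apply: I2. Qed.

Lemma ada_pairs_injW P m m' w :
  (m, w) \in ada_pairs P -> (m', w) \in ada_pairs P -> m = m'.
Proof. by case: (ada_inv_after P (ada_last_round P)) => _ _ I3 _; apply: I3. Qed.

Lemma ada_has_wife P m : exists w, (m, w) \in ada_pairs P.
Proof.
rewrite /ada_pairs /ada_last_round; case: ex_minnP => k /forallP /(_ m) + _.
by rewrite negb_forall => /existsP[w]; rewrite negbK; exists w.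
Qed.

Lemma ada_has_husband P w : exists m, (m, w) \in ada_pairs P.
Proof.
pose g m := xchoose (ada_has_wife P m).
have gP m : (m, g m) \in ada_pairs P := xchooseP (ada_has_wife P m).
have ginj : injective g.
  by move=> m m' e; apply: (ada_pairs_injW (gP m)); rewrite e.
have : w \in codom g by apply: inj_card_onto; rewrite ?cardMW.
by case/codomP=> m ->; exists m.
Qed.

(* The woman, resp. man, paired with m, resp. w, in [ada_pairs P]; unique by
   [ada_pairs_inj] and [ada_pairs_injW]. *)
Definition ada_wife P m : W := xchoose (ada_has_wife P m).
Definition ada_husband P w : M := xchoose (ada_has_husband P w).

Lemma ada_matchingP P m w : ada_wife P m = w <-> ada_husband P w = m.
Proof.
have wP : (m, ada_wife P m) \in ada_pairs P := xchooseP (ada_has_wife P m).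
have hP : (ada_husband P w, w) \in ada_pairs P := xchooseP (ada_has_husband P w).
split=> e.
  by apply: (ada_pairs_injW hP); rewrite -e.
by apply: (ada_pairs_inj wP); rewrite -e.
Qed.

Definition ada : allocation_rule M W :=
  fun P => Matching (ada_matchingP P).

Lemma ada_wifeE P m w : wife (ada P) m = w <-> (m, w) \in ada_pairs P.
Proof.
have wP : (m, ada_wife P m) \in ada_pairs P := xchooseP (ada_has_wife P m).
split=> [<- //|mw]; exact: ada_pairs_inj wP mw.
Qed.

End Output.
End Algorithm.

(* Main.v *)
(* The output of ADA is stable, and it satisfies the Gale-Sotomayor blocking
   lemma: if some men strictly prefer a matching nu to the ADA matching mu, then
   nu is blocked by a woman and a man who does not strictly prefer nu to mu.
   Were a misreport by m to yield a matching nu that m truly prefers to mu, the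
   blocking man would not be m, so the pair would also block nu under the
   misreported profile, contradicting the stability of nu there. *)
Require Import Defs.
From HB Require Import structures.
From mathcomp Require Import all_boot.

Set Implicit Arguments.
Unset Strict Implicit.
Unset Printing Implicit Defensive.

Lemma pref_irr (T : Type) (r : pref T) x : r x x = false.
Proof. by case: (pref_slo r). Qed.

Lemma pref_trans (T : Type) (r : pref T) : transitive r.
Proof. by case: (pref_slo r). Qed.

Lemma pref_asym (T : Type) (r : pref T) x y : r x y -> r y x -> False.
Proof. by move=> rxy /(pref_trans rxy); rewrite pref_irr. Qed.

Lemma pref_total (T : eqType) (r : pref T) x y : x != y -> r x y || r y x.
Proof. by move/eqP=> nxy; case: (pref_slo r) => _ _; apply. Qed.

Lemma wifeK (M W : Type) (mu : matching M W) : cancel (wife mu) (husband mu).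
Proof. by move=> m; apply/(matchingP mu). Qed.

Lemma husbandK (M W : Type) (mu : matching M W) : cancel (husband mu) (wife mu).
Proof. by move=> w; apply/(matchingP mu). Qed.

Section Rounds.
Variables (M W : finType) (P : profile M W).
Implicit Types (m : M) (w : W).

Lemma proposersP s m w : m \in proposers P s w ->
  (m, w) \in matched s \/
  single s m /\ is_best (mpref P m) [set w' | (m, w') \notin rejected s] w.
Proof. by rewrite inE => /orP[|/andP[]]; [left | right]. Qed.

Lemma rejected_mono j k : j <= k ->
  rejected (ada_after P j) \subset rejected (ada_after P k).
Proof.
move/subnK <-; elim: (k - j) => // d IH.
exact: subset_trans IH (subsetUl _ _).
Qed.

(** A man proposes to his best woman among those who have not rejected him, and while he stays
    matched this set of women can only shrink. *)
Lemma matched_best k m w w' :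
  (m, w) \in matched (ada_after P k) ->
  (m, w') \notin rejected (ada_after P k) -> w' != w -> mpref P m w w'.
Proof.
elim: k w => [|k IH] w; first by rewrite inE.
rewrite !inE /= => /is_best_in/proposersP mw /norP[nrej _] nw.
case: mw => [mw|[_ b]]; first exact: IH.
by apply: is_best_rel b _ nw; rewrite inE.
Qed.

Lemma proposers_best k m w w' :
  m \in proposers P (ada_after P k) w ->
  (m, w') \notin rejected (ada_after P k) -> w' != w -> mpref P m w w'.
Proof.
case/proposersP=> [|[_ b] nrej nw]; first exact: matched_best.
by apply: is_best_rel b _ nw; rewrite inE.
Qed.

(** The previous partner is again among the proposers, so a woman only trades up and every later
    partner still justifies her earlier rejections. *)
Lemma matched_over_rejected k m m' w :
  (m', w) \in matched (ada_after P k) ->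
  (m, w) \in rejected (ada_after P k) -> wpref P w m' m.
Proof.
elim: k m m' => [|k IH] m m'; first by rewrite inE.
rewrite !inE /= => acc /orP[rej|/existsP[m2 /andP[acc2]]]; last first.
  by rewrite (is_best_uniq acc acc2).
have [_ _ _ /(_ _ _ rej)[m2 m2w]] := ada_inv_after P k.
have m2P : m2 \in proposers P (ada_after P k) w by rewrite inE m2w.
have [<-|ne] := eqVneq m2 m'; first exact: IH.
exact: pref_trans (is_best_rel acc m2P ne) (IH _ _ m2w rej).
Qed.

End Rounds.

Section Output.
Variables (M W : finType) (n : nat) (cardM : #|M| = n) (cardW : #|W| = n).
Variable P : profile M W.
Let mu := ada cardM cardW P.
Let T := ada_last_round cardM cardW P.

Lemma ada_matched m : (m, wife mu m) \in matched (ada_after P T).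
Proof. exact/(ada_wifeE cardM cardW). Qed.

Lemma ada_stable m w :
  mpref P m w (wife mu m) -> wpref P w (husband mu w) m.
Proof.
move=> pw; apply: (@matched_over_rejected _ _ _ T).
  by rewrite -{2}(husbandK mu w); apply: ada_matched.
apply/negPn/negP => nrej; apply: (pref_asym pw).
apply: matched_best (ada_matched m) nrej _.
by apply/eqP => e; rewrite e pref_irr in pw.
Qed.

Lemma ada_blocking (nu : matching M W) m1 :
  mpref P m1 (wife nu m1) (wife mu m1) ->
  exists m w, [/\ ~~ mpref P m (wife nu m) (wife mu m),
    mpref P m w (wife nu m) & wpref P w m (husband nu w)].
Proof.
move=> gain1.
pose A := [set m | mpref P m (wife nu m) (wife mu m)].
have m1A : m1 \in A by rewrite inE.
(* If some [m] in [A] takes his [nu]-wife [w] from a man [m0] outside [A], then [m0] strictly loses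
   under [nu], and stability of [mu] makes [w] prefer [m0] to [m]. *)
have [/exists_inP[m mA nA]|] :=
    boolP [exists m in A, husband mu (wife nu m) \notin A].
  set w := wife nu m in nA; set m0 := husband mu w in nA.
  have muw : wife mu m0 = w := husbandK mu w.
  rewrite inE in mA.
  rewrite inE in nA.
  have ww : wife nu m0 != w.
    apply/eqP => e; move: nA.
    by rewrite -[m0](wifeK nu) e /w wifeK mA.
  exists m0, w; split=> //.
    by have := pref_total (mpref P m0) ww; rewrite -{1}muw (negbTE nA).
  by rewrite /w wifeK; apply: ada_stable.
rewrite negb_exists_in => /forall_inP closedA.
(* An injective self-map of the finite set [A] is onto, so [mu] and [nu] marry [A] to the same
   women. *)
have imA : (fun m => husband mu (wife nu m)) @: A = A.
  apply/eqP; rewrite eqEcard card_imset ?leqnn ?andbT.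
    by apply/subsetP => _ /imsetP[m /closedA + ->]; rewrite negbK.
  by apply: inj_comp; [apply: can_inj (husbandK mu) | apply: can_inj (wifeK nu)].
have nuA m : m \in A -> husband nu (wife mu m) \in A.
  by rewrite -{1}imA => /imsetP[m' m'A ->]; rewrite husbandK wifeK.
(* Look at the first round after which all of A is matched as in mu. *)
pose settled k := [forall m in A, (m, wife mu m) \in matched (ada_after P k)].
have settledT : settled T by apply/forall_inP => m _; apply: ada_matched.
case: (ex_minnP (ex_intro settled T settledT)) => [[|k]] /forall_inP stl min.
  by have := stl _ m1A; rewrite inE.
have kT : k <= T := ltnW (min _ settledT).
have : ~~ settled k by apply/negP => /min; rewrite ltnn.
rewrite negb_forall_in => /exists_inP[m mA nmw].
set w := wife mu m in nmw; set m2 := husband nu w.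
have m2A : m2 \in A := nuA _ mA.
(* In round [k.+1] the man [m2] is a proposer of his [mu]-wife although he prefers [w], so [w] has
   already rejected him. *)
have rej2 : (m2, w) \in rejected (ada_after P k).
  have := stl _ m2A; rewrite inE /= => /is_best_in pr2.
  have := m2A; rewrite inE husbandK => gain2.
  apply/negPn/negP => nrej; apply: (pref_asym gain2).
  apply: proposers_best pr2 nrej _.
  by apply/eqP => e; rewrite e pref_irr in gain2.
(* Having rejected someone, [w] holds a partner [m0], whom she drops for [m] in round [k.+1]; he is
   the blocking man. *)
have [_ uniqW _ /(_ _ _ rej2)[m0 m0w]] := ada_inv_after P k.
have nm0 : m0 != m by apply/eqP => e; rewrite -e in nmw; rewrite m0w in nmw.
have nw0 : wife mu m0 != w.
  by rewrite (can_eq (wifeK mu)).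
(* Being held by [w] at the start of round [k.+1], [m0] cannot propose in it, so he does not end it
   with his [mu]-wife as all of [A] does. *)
have nA0 : m0 \notin A.
  apply/negP => /stl; rewrite inE /= => /is_best_in/proposersP[m0w'|[]].
    by case/eqP: nw0; apply: uniqW m0w' m0w.
  by rewrite (not_single m0w).
(* The [mu]-wife of [m0] holds him after round [T], so she has not rejected him by round [k], when
   he is with [w]. *)
have gain0 : mpref P m0 w (wife mu m0).
  apply: matched_best m0w _ nw0; apply/negP => /(subsetP (rejected_mono P kT)).
  by apply/negP; have [-> //] := ada_inv_after P T; apply: ada_matched.
exists m0, w; split; first by rewrite inE in nA0.
  have [->//|/(pref_total (mpref P m0))] := eqVneq (wife nu m0) (wife mu m0).
  rewrite inE in nA0; rewrite (negbTE nA0); exact: pref_trans gain0.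
exact: matched_over_rejected m0w rej2.
Qed.

End Output.

Theorem theorem2 (n : nat) (hn : 2 <= n) (M W : finType)
    (hM : #|M| = n) (hW : #|W| = n) :
  strategy_proof_for_men (ada hM hW).
Proof.
move=> m r r' P; cbv zeta.
have := @ada_stable _ _ _ hM hW (report P m r').
have := @ada_blocking _ _ _ hM hW (report P m r).
move: (ada _ _ (report P m r)) (ada _ _ (report P m r')) => mu mu' blocking stable.
have [->|/(pref_total r)/orP[|gain]] := eqVneq (wife mu m) (wife mu' m).
- by left.
- by right.
have [|m0 [w [ngain pm pw]]] := blocking mu' m; first by rewrite /= eqxx.
have nm : m0 != m by apply: contraNneq ngain => ->; rewrite /= eqxx.
case: (pref_asym pw); apply: stable.
by move: pm; rewrite /= (negbTE nm).
Qed.
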